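(* For any real-valued function $r(N)$ of the positive integer $N$ with $\lim_{N\to\infty}r(N)=\infty$ we have $$E_N^{rat-sym}\ge 2^{N/2-r(N)+o(1)}.$$ Moreover, we have $$E_N^{2-adic-sym}\ge \frac{N}{2}-\log(N)+o(1).$$ Here $o(1)$ denotes a function of $N$ tending to $0$ as $N\to\infty$ (in the first bound it may depend on the function $r$).
   Context: For a binary vector $\mathcal{S}_N=(s_0,\ldots,s_{N-1})\in\{0,1\}^N$, the $N$th rational complexity is $$\Lambda(\mathcal{S}_N)=\min\left\{\max\{q,|f|\}: q\sum_{n=0}^{N-1}s_n2^n\equiv f\bmod 2^N,\ q>0 \mbox{ odd}\right\},$$ where $q,f$ range over integers, and the $N$th 2-adic complexity is $\lambda(\mathcal{S}_N)=\log_2(\Lambda(\mathcal{S}_N))$. The reverse of $\mathcal{S}_N$ is $\mathcal{S}_N^{rev}=(s_{N-1},s_{N-2},\ldots,s_0)$. For $N\ge 2$ put $\Lambda^{sym}(\mathcal{S}_N)=\min\{\Lambda(\mathcal{S}_N),\Lambda(\mathcal{S}_N^{rev})\}$ and $\lambda^{sym}(\mathcal{S}_N)=\min\{\lambda(\mathcal{S}_N),\lambda(\mathcal{S}_N^{rev})\}$. The expected values are $$E_N^{rat-sym}=\frac{1}{2^N}\sum_{\mathcal{S}_N\in\{0,1\}^N}\Lambda^{sym}(\mathcal{S}_N),\qquad E_N^{2-adic-sym}=\frac{1}{2^N}\sum_{\mathcal{S}_N\in\{0,1\}^N}\lambda^{sym}(\mathcal{S}_N).$$ $\log$ denotes the natural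 logarithm and $\log_2$ the logarithm in base $2$. *)

(* Defs.v *)
From HB Require Import structures.
From mathcomp Require Import all_boot all_order all_algebra.
From mathcomp Require Import all_classical all_reals all_analysis.

Set Implicit Arguments.
Unset Strict Implicit.
Unset Printing Implicit Defensive.

Import Order.TTheory GRing.Theory Num.Theory.
Import numFieldNormedType.Exports.

Local Open Scope ring_scope.

Section Complexity.
Variable N : nat.
Implicit Type s : N.-tuple bool.

Definition seq_int s : int := \sum_(n < N) (tnth s n)%:R * 2 ^+ n.

Definition rat_approx s (q f : int) : Prop :=
  [/\ 0 < q, ~~ (2 %| q)%Z & (q * seq_int s = f %[mod 2 ^+ N])%Z].

Definition rat_value s (m : nat) : Prop :=
  exists q f : int, rat_approx s q f /\ m%:Z = Num.max q `|f|.

(* The pair (q, f) = (1, seq_int s) shows that the minimum is over a nonempty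
   set. *)
Lemma rat_value_nonempty s : exists m, `[< rat_value s m >].
Proof.
exists (absz (Num.max 1%:Z `|seq_int s|)); apply/asboolP.
exists 1, (seq_int s); split; first by split=> //; rewrite mul1r.
by rewrite abszE ger0_norm // le_max ler01.
Qed.

Definition rat_complexity s : nat := ex_minn (rat_value_nonempty s).

Definition rat_complexity_sym s : nat :=
  minn (rat_complexity s) (rat_complexity [tuple of rev s]).

Variable R : realType.

Definition log2 (x : R) : R := ln x / ln 2.

Definition two_adic_complexity s : R := log2 (rat_complexity s)%:R.

Definition two_adic_complexity_sym s : R :=
  Num.min (two_adic_complexity s) (two_adic_complexity [tuple of rev s]).

Definition E_rat_sym : R :=
  (2 ^+ N)^-1 * \sum_(s : N.-tuple bool) (rat_complexity_sym s)%:R.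

Definition E_two_adic_sym : R :=
  (2 ^+ N)^-1 * \sum_(s : N.-tuple bool) two_adic_complexity_sym s.

End Complexity.

(* Main.v *)
Require Import Defs.
From HB Require Import structures.
From mathcomp Require Import all_boot all_order all_algebra.
From mathcomp Require Import all_classical all_reals all_analysis.
From mathcomp Require Import zify ring lra.

Set Implicit Arguments.
Unset Strict Implicit.
Unset Printing Implicit Defensive.

Import Order.TTheory GRing.Theory Num.Theory.
Import numFieldNormedType.Exports.

Local Open Scope classical_set_scope.
Local Open Scope ring_scope.

(* An odd denominator q > 0 and a numerator f determine s modulo 2^N, so at most
   (K+1)(2K+1) vectors have rational complexity at most K >= 1, and at most
   2(K+1)(2K+1) <= 12 K^2 have symmetric complexity at most K.  Hence all but
   12 x^2 of the 2^N vectors have symmetric complexity at least x, and Markov's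
   inequality bounds the expectations below by (1 - 12 x^2/2^N) x and
   (1 - 12 x^2/2^N) log2 x.  Taking x^2 = 2^N/24 in the first and x^2 = 2^N/N in
   the second yields c 2^(N/2) and N/2 - log2(N)/2 - O(1); the latter suffices
   because 1/(2 ln 2) < 1. *)

(** By induction on [N]: reducing modulo 2 forces the lowest digits to agree, and after cancelling
    them a factor 2 divides out and the shifted digit sequences remain. *)
Lemma binary_digits_inj_mod (N : nat) (a b : nat -> bool) :
  (2 ^+ N %| \sum_(n < N) ((a n)%:R - (b n)%:R) * 2 ^+ n)%Z ->
  forall n, (n < N)%N -> a n = b n.
Proof.
elim: N a b => [//|N IHN] a b.
rewrite big_ord_recl expr0 mulr1.
under eq_bigr => i _ do rewrite lift0 exprSr mulrA.
rewrite -mulr_suml => dvd_ab.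
have ab0 : a 0%N = b 0%N.
  move: (dvdz_trans (dvdz_exp2l 2 (ltn0Sn N)) dvd_ab).
  rewrite expr1 rpredDr; last exact: dvdz_mull.
  by case: (a 0%N) (b 0%N) => [] [].
move: dvd_ab; rewrite ab0 subrr add0r exprSr dvdz_mul2r //.
move=> /(IHN (a \o S) (b \o S)) abS.
by case=> [//|n] ltnN; apply: (abS n).
Qed.

Lemma seq_int_inj_mod (N : nat) (s t : N.-tuple bool) :
  (seq_int s = seq_int t %[mod 2 ^+ N])%Z -> s = t.
Proof.
move=> /eqP; rewrite eqz_mod_dvd -sumrB.
under eq_bigr => n _ do rewrite -mulrBl !(tnth_nth false).
move=> /(binary_digits_inj_mod (a := nth false s)) st.
by apply: eq_from_tnth => n; rewrite !(tnth_nth false) st.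
Qed.

(** An odd [q] is invertible modulo [2 ^+ N], so it cancels from the two congruences. *)
Lemma rat_approx_inj (N : nat) (s t : N.-tuple bool) (q f : int) :
  rat_approx s q f -> rat_approx t q f -> s = t.
Proof.
move=> [_ odd_q s_qf] [_ _ t_qf]; apply: seq_int_inj_mod.
have cop : coprimez (2 ^+ N) q.
  by rewrite coprimezXl // coprimezE coprime2n -[odd _]negbK -dvdn2.
have /eqP : (q * seq_int s = q * seq_int t %[mod 2 ^+ N])%Z by rewrite s_qf.
rewrite eqz_mod_dvd -mulrBr Gauss_dvdzr // => dvd_st.
by apply/eqP; rewrite eqz_mod_dvd.
Qed.

Lemma rat_complexityP (N : nat) (s : N.-tuple bool) :
  exists q f : int, rat_approx s q f /\ (rat_complexity s)%:Z = Num.max q `|f|.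
Proof. by rewrite /rat_complexity; case: ex_minnP => m /asboolP. Qed.

Lemma rat_complexity_gt0 (N : nat) (s : N.-tuple bool) :
  (0 < rat_complexity s)%N.
Proof.
have [q [f [[q0 _ _] Eqf]]] := rat_complexityP s.
by rewrite -ltz_nat Eqf lt_max q0.
Qed.

Lemma rat_complexity_sym_gt0 (N : nat) (s : N.-tuple bool) :
  (0 < rat_complexity_sym s)%N.
Proof. by rewrite /rat_complexity_sym leq_min !rat_complexity_gt0. Qed.

Lemma card_rat_complexity_le (N K : nat) :
  (#|[pred s : N.-tuple bool | rat_complexity s <= K]|
     <= K.+1 * (2 * K).+1)%N.
Proof.
have /choice[qf qfP] (s : N.-tuple bool) : exists qf : int * int,
    rat_approx s qf.1 qf.2 /\
    (rat_complexity s)%:Z = Num.max qf.1 `|qf.2|.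
  by have [q [f sP]] := rat_complexityP s; exists (q, f).
(* A minimal pair satisfies [0 < q <= K] and [-K <= f <= K]. Shifting [f] by [K] makes it a natural
   number at most [2 * K], so [inord] never falls back to its default here. *)
pose code s : 'I_K.+1 * 'I_(2 * K).+1 :=
  (inord (absz (qf s).1), inord (absz ((qf s).2 + K%:Z))).
rewrite -[X in (_ <= X * _)%N]card_ord -[X in (_ <= _ * X)%N]card_ord.
rewrite -card_prod.
apply: (@leq_card_in _ _ code) => s t; rewrite !inE => sK tK.
have [sqf Es] := qfP s; have [tqf Et] := qfP t.
have [q0s _ _] := sqf; have [q0t _ _] := tqf.
move=> [/(congr1 val) + /(congr1 val)]; rewrite /= !inordK; [|lia..].
move=> Eq Ef; apply: (rat_approx_inj sqf).
by have [-> ->] : (qf s).1 = (qf t).1 /\ (qf s).2 = (qf t).2 by lia.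
Qed.

Lemma card_rat_complexity_sym_lt (R : realType) (N : nat) (x : R) : 0 <= x ->
  #|[pred s : N.-tuple bool | (rat_complexity_sym s)%:R < x]|%:R
    <= 12 * x ^+ 2.
Proof.
move=> x0; set K := Num.truncn x.
have Kx : K%:R <= x by rewrite /K; have /andP[] := truncn_itv x0.
apply: (@le_trans _ _ (12 * K%:R ^+ 2)); last first.
  by rewrite ler_pM2l // lerXn2r ?nnegrE.
rewrite -natrX -natrM ler_nat.
pose low := [pred s : N.-tuple bool | rat_complexity s <= K]%N.
have rev_inv : involutive (fun s : N.-tuple bool => [tuple of rev s]).
  by move=> s; apply: val_inj; rewrite /= revK.
pose lowrev := [pred s : N.-tuple bool | [tuple of rev s] \in low].
(* The estimate by [12 * K ^ 2] needs [K >= 1]. If [K = 0] then [x < 1], and no vector counts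
   because complexities are positive. *)
have [K0|K0] := posnP K.
  rewrite eq_card0 // => s; rewrite !inE; apply/negbTE; rewrite -leNgt.
  have : x < 1 by have /andP[_] := truncn_itv x0; rewrite -/K K0.
  move/ltW/le_trans; apply; by rewrite ler1n rat_complexity_sym_gt0.
have card_lowrev : (#|lowrev| <= #|low|)%N.
  rewrite (card_preim (inv_inj rev_inv)); apply: subset_leq_card.
  by apply/fintype.subsetP => s; rewrite inE => /andP[].
(* Since [x < K + 1], a complexity below [x] is at most [K]; hence [s] or its reverse lies in
   [low]. *)
apply: (@leq_trans (#|low| + #|lowrev|)%N).
  rewrite -cardUI; apply: leq_trans (leq_addr _ _); apply: subset_leq_card.
  apply/fintype.subsetP => s; rewrite !inE => sx.
  rewrite -geq_min leqNgt; apply/negP => Ks; move: sx; apply/negP.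
  rewrite -leNgt (le_trans (ltW _) (_ : K.+1%:R <= _)) ?ler_nat //.
  by have /andP[] := truncn_itv x0.
(* For [K >= 1], [K + 1 <= 2 * K] and [2 * K + 1 <= 3 * K]. *)
have := card_rat_complexity_le N K; rewrite -/low; nia.
Qed.

Lemma markov_sum (R : realType) (T : finType) (F : T -> R) (y : R) :
  (forall t, 0 <= F t) ->
  (#|T|%:R - #|[pred t | F t < y]|%:R) * y <= \sum_t F t.
Proof.
move=> F0; rewrite -(cardC [pred t | F t < y]) natrD addrC addKr.
rewrite (bigID [pred t | F t < y]) /= -[leLHS]add0r; apply: lerD.
  by apply: sumr_ge0.
rewrite mulrC mulr_natr -sumr_const.
by apply: ler_sum => t; rewrite !inE -leNgt.
Qed.

(** Turns each o(1) claim into an inequality for large [N]: the minimum of 0 and [d N] is eventually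
    0, and it absorbs the finitely many exceptions. *)
Lemma eventually_nneg_slack (R : realType) (d : nat -> R) :
  (\forall N \near \oo, 0 <= d N) ->
  exists e : nat -> R, e N @[N --> \oo] --> 0 /\ forall N, e N <= d N.
Proof.
move=> d0; exists (fun N => Num.min 0 (d N)); split; last first.
  by move=> N; rewrite ge_min lexx orbT.
by apply: cvg_near_cst; apply: filterS d0 => N dN; apply/min_idPl.
Qed.

(** Shared by both expectations: [y] is [x] for the rational one and [log2 x] for the 2-adic one. *)
Lemma mean_ge_of_rat_complexity_sym (R : realType) (N : nat) (x y S : R) :
  0 <= x -> 0 <= y ->
  (2 ^+ N - #|[pred s : N.-tuple bool | (rat_complexity_sym s)%:R < x]|%:R) * y
    <= S ->
  (1 - 12 * (x ^+ 2 / 2 ^+ N)) * y <= (2 ^+ N)^-1 * S.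
Proof.
move=> x0 y0 /(le_trans _) leS.
rewrite [leRHS]mulrC ler_pdivlMr ?exprn_gt0 // leS //.
rewrite mulrAC ler_wpM2r // mulrBl mul1r -mulrA divfK ?expf_neq0 //.
by rewrite lerD2l lerN2 card_rat_complexity_sym_lt.
Qed.

Lemma E_rat_sym_ge (R : realType) (N : nat) (x : R) : 0 <= x ->
  (1 - 12 * (x ^+ 2 / 2 ^+ N)) * x <= E_rat_sym N R.
Proof.
move=> x0; apply: mean_ge_of_rat_complexity_sym => //.
have := markov_sum (T := N.-tuple bool)
  (F := fun s => (rat_complexity_sym s)%:R) x (fun=> ler0n _ _).
by rewrite card_tuple card_bool natrX.
Qed.

(** The logarithm is increasing, so it commutes with the minimum; the count for rational complexity
    then also serves the 2-adic one. *)
Lemma two_adic_complexity_symE (R : realType) (N : nat) (s : N.-tuple bool) :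
  two_adic_complexity_sym R s = log2 (rat_complexity_sym s)%:R.
Proof.
rewrite /two_adic_complexity_sym /two_adic_complexity /rat_complexity_sym.
have ln20 : 0 < ln 2 :> R by rewrite ln_gt0 // ltr1n.
case: (leqP (rat_complexity s)) => [le_s|/ltnW le_s].
  by apply/min_idPl; rewrite ler_pM2r ?invr_gt0 // ler_ln ?posrE ?ltr0n
    ?rat_complexity_gt0 // ler_nat.
by apply/min_idPr; rewrite ler_pM2r ?invr_gt0 // ler_ln ?posrE ?ltr0n
  ?rat_complexity_gt0 // ler_nat.
Qed.

Lemma E_two_adic_sym_ge (R : realType) (N : nat) (x : R) : 1 <= x ->
  (1 - 12 * (x ^+ 2 / 2 ^+ N)) * log2 x <= E_two_adic_sym N R.
Proof.
move=> x1; have x0 : 0 < x by apply: lt_le_trans x1.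
have ln20 : 0 < ln 2 :> R by rewrite ln_gt0 // ltr1n.
apply: mean_ge_of_rat_complexity_sym; first exact: ltW.
  by rewrite divr_ge0 ?ln_ge0 // ler1n.
have F0 (s : N.-tuple bool) : 0 <= two_adic_complexity_sym R s.
  rewrite two_adic_complexity_symE divr_ge0 ?(ltW ln20) // ln_ge0 //.
  by rewrite ler1n rat_complexity_sym_gt0.
have := markov_sum (log2 x) F0; rewrite card_tuple card_bool natrX.
rewrite (@eq_card _ _ [pred s | (rat_complexity_sym s)%:R < x]) // => s.
rewrite !inE.
rewrite two_adic_complexity_symE ltr_pM2r ?invr_gt0 // ltr_ln ?posrE //.
by rewrite ltr0n rat_complexity_sym_gt0.
Qed.

(** From [1 + t < expR t] at [t = - ln 2], where the right side is 1/2. *)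
Lemma ln2_gt_half (R : realType) : 2^-1 < ln 2 :> R.
Proof.
have ln20 : 0 < ln 2 :> R by rewrite ln_gt0 // ltr1n.
have : 1 + - ln 2 < expR (- ln 2) :> R by rewrite expR_gt1Dx // oppr_eq0 gt_eqF.
by rewrite expRN lnK ?posrE //; lra.
Qed.

Lemma log2_sqrt_div (R : realType) (N : nat) (M : R) : 0 < M ->
  log2 (Num.sqrt (2 ^+ N / M)) = (N%:R - log2 M) / 2.
Proof.
move=> M0; have ln20 : ln 2 != 0 :> R by rewrite gt_eqF // ln_gt0 // ltr1n.
set x := Num.sqrt _.
have y0 : 0 < 2 ^+ N / M by rewrite divr_gt0 ?exprn_gt0.
have : ln (x ^+ 2) = ln (2 ^+ N / M) by rewrite sqr_sqrtr // ltW.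
rewrite lnXn ?sqrtr_gt0 // ln_div ?posrE ?exprn_gt0 // lnXn //.
rewrite -(mulr_natr (ln 2) N) => lnx.
have -> : log2 x = (ln 2 * N%:R - ln M) / 2 / ln 2 by rewrite -lnx /log2; lra.
by rewrite /log2; field.
Qed.

Theorem theorem2 (R : realType) :
  (forall r : nat -> R, r N @[N --> \oo] --> +oo ->
     exists e : nat -> R, e N @[N --> \oo] --> 0 /\
       forall N : nat, (2 <= N)%N ->
         2 `^ (N%:R / 2 - r N + e N) <= E_rat_sym N R) /\
  (exists e : nat -> R, e N @[N --> \oo] --> 0 /\
     forall N : nat, (2 <= N)%N ->
       N%:R / 2 - ln N%:R + e N <= E_two_adic_sym N R).
Proof.
have ln2_half := ln2_gt_half R.
have ln20 : 0 < ln 2 :> R by apply: lt_trans ln2_half.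
have sqr_sqrt N (M : R) : 0 < M -> Num.sqrt (2 ^+ N / M) ^+ 2 / 2 ^+ N = M^-1.
  move=> M0; rewrite sqr_sqrtr ?divr_ge0 ?exprn_ge0 ?(ltW M0) //.
  by rewrite mulrAC divff ?mul1r // expf_neq0.
split=> [r r_oo|].
(* With [x ^+ 2 = 2 ^+ N / 24] the factor [1 - 12 * (x ^+ 2 / 2 ^+ N)] equals 1/2. *)
- have E_ge N : Num.sqrt (2 ^+ N / 24) / 2 <= E_rat_sym N R.
    apply: le_trans (E_rat_sym_ge N (sqrtr_ge0 (2 ^+ N / 24))).
    rewrite sqr_sqrt //.
    by have := sqrtr_ge0 (2 ^+ N / 24 : R); lra.
  have x0 N : 0 < Num.sqrt (2 ^+ N / 24) / 2 :> R.
    by rewrite divr_gt0 // sqrtr_gt0 divr_gt0 ?exprn_gt0.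
  have E0 N : 0 < E_rat_sym N R by apply: lt_le_trans (E_ge N).
  have [|e [e0 e_le]] := @eventually_nneg_slack R
      (fun N => log2 (E_rat_sym N R) - N%:R / 2 + r N).
    (* The threshold for [r N] is the amount by which [log2] of the lower bound falls short of
       [N / 2]: [log2 24 / 2] from the root and 1 from the halving. *)
    move/cvgryPge : r_oo => /(_ (log2 24 / 2 + 1)); apply: filterS => N rN.
    have : log2 (Num.sqrt (2 ^+ N / 24) / 2) <= log2 (E_rat_sym N R).
      by rewrite ler_pM2r ?invr_gt0 // ler_ln ?posrE.
    rewrite {1}/log2 ln_div ?posrE ?sqrtr_gt0 ?divr_gt0 ?exprn_gt0 //.
    rewrite mulrBl divff ?gt_eqF // -/(log2 _) log2_sqrt_div //.
    by move: rN; lra.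
  exists e; split=> // N _.
  rewrite -[leRHS]lnK ?posrE // /powR gt_eqF // ler_expR -ler_pdivlMr //.
  by have := e_le N; rewrite /log2; lra.
- have [|e [e0 e_le]] := @eventually_nneg_slack R
      (fun N => E_two_adic_sym N R - N%:R / 2 + ln N%:R); last first.
    by exists e; split=> // N _; have := e_le N; lra.
  (* Since [log2 N / 2 = (1 - c) * ln N], the claimed bound leaves a margin of [c * ln N]. *)
  pose c : R := 1 - (2 * ln 2)^-1.
  have c0 : 0 < c.
    by rewrite subr_gt0 invf_lt1 ?mulr_gt0 //; lra.
  near=> N.
  have N12 : 12 <= N%:R :> R by near: N; exact: nbhs_infty_ger.
  have N0 : 0 < N%:R :> R by apply: lt_le_trans N12.
  (* From here on the margin [c * ln N] covers the constant 6 lost as [12 / N * (N / 2)] in the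
     expansion below. *)
  have lnN : 6 / c <= ln N%:R.
    rewrite -[leLHS]expRK ler_ln ?posrE ?expR_gt0 //.
    by near: N; exact: nbhs_infty_ger.
  have x1 : 1 <= Num.sqrt (2 ^+ N / N%:R) :> R.
    rewrite -[leLHS]sqrtr1 ler_sqrt ?divr_gt0 ?exprn_gt0 //.
    by rewrite ler_pdivlMr // mul1r -natrX ler_nat ltnW // ltn_expl.
  have := E_two_adic_sym_ge N x1; rewrite sqr_sqrt // log2_sqrt_div //.
  move: lnN; rewrite ler_pdivrMr // => lnN.
  have -> : (1 - 12 * N%:R^-1) * ((N%:R - log2 N%:R) / 2) =
      N%:R / 2 - 6 + 6 / N%:R * log2 N%:R - log2 N%:R / 2 :> R.
    by field; rewrite gt_eqF.
  (* This cross term has a favourable sign and is simply dropped from the lower bound. *)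
  have logN0 : 0 <= 6 / N%:R * log2 N%:R :> R.
    rewrite mulr_ge0 ?divr_ge0 ?(ltW ln20) // ln_ge0 //.
    by apply: le_trans N12; rewrite ler1n.
  have -> : log2 N%:R / 2 = ln N%:R * (1 - c) :> R.
    by rewrite /log2 /c; field; rewrite gt_eqF.
  by lra.
Unshelve. all: by end_near. Qed.
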